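(* Let $G$ be a weakly connected and weight-balanced weighted directed graph on $N\ge2$ nodes with Laplacian matrix $L$, and let $\Delta>0$. Consider the hybrid system (H) of consensus with hysteretic quantizers described in the context, and let $z=(x,q)$ be its complete solution with initial condition $z(0,0)\in X_0$. Then for any $\varepsilon\in(0,1)$ there exists $T(\varepsilon)>0$ such that $$\left\|x(t,j)-\frac{\mathbf 1\mathbf 1^*}{N}x(0,0)\right\|\le\frac{1}{1-\varepsilon}\,\frac{\|L\|}{\lambda_2(\mathrm{Sym}(L))}\,\frac{\Delta}{2}\sqrt N$$ for all $(t,j)\in\mathrm{dom}\,z$ such that $t\ge T(\varepsilon)$.
   Context: A weighted directed graph $G=(V,E,A)$ has node set $V=\{1,\dots,N\}$, edge set $E\subset V\times V$ without self-loops, and adjacency matrix $A\in\mathbb{R}_{\ge0}^{N\times N}$ with $A_{ij}>0$ if $(j,i)\in E$ and $A_{ij}=0$ otherwise. It is weight-balanced if $\sum_j A_{ij}=\sum_j A_{ji}$ for every $i$; weakly connected if any two nodes are joined by a path of edges, disregarding orientation. $\mathbf 1$ is the all-ones vector, $L=\mathrm{diag}(A\mathbf 1)-A$, $\mathrm{Sym}(L)=\frac{L+L^*}{2}$, and $\lambda_2(\mathrm{Sym}(L))$ is the smallest nonzero eigenvalue of $\mathrm{Sym}(L)$. $\|\cdot\|$ is the Euclidean norm for vectors and the induced norm for matrices. Hybrid system (H). Let $Q=\Delta\mathbb{Z}\cup(\Delta\mathbb{Z}+\Delta/2)$ and $X=\mathbb{R}^N\times Q^N$, with states $z=(x,q)$.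 Let $C=\{(x,q)\in X:\ q_i-\frac\Delta2<x_i<q_i+\frac\Delta2\ \forall i\in V\}$ and $D=X\setminus C$, i.e. $D=\{(x,q)\in X:\exists i\in V,\ x_i\le q_i-\frac\Delta2\text{ or }x_i\ge q_i+\frac\Delta2\}$. On $C$ the state flows: $\dot z=f(z)$, i.e. $\dot x=-Lq$, $\dot q=0$. On $D$ the state jumps: $z^+=g(z)$, i.e. $x^+=x$ and, for each $i$, $q_i^+=q_i+\frac\Delta2$ if $x_i\ge q_i+\frac\Delta2$, $q_i^+=q_i-\frac\Delta2$ if $x_i\le q_i-\frac\Delta2$, $q_i^+=q_i$ otherwise. Initial conditions belong to $X_0=\{(x,q)\in X:\ q_i-\frac\Delta2\le x_i<q_i+\frac\Delta2\ \forall i\in V\}$. A hybrid time domain is a subset of $\mathbb{R}_{\ge0}\times\mathbb{N}$ that is the union of infinitely many intervals $[t_j,t_{j+1}]\times\{j\}$, $j=0,1,2,\dots$, with $0=t_0\le t_1\le t_2\le\cdots$, or of finitely many such intervals, with the last one possibly of the form $[t_j,t_{j+1}]\times\{j\}$, $[t_j,t_{j+1})\times\{j\}$ or $[t_j,+\infty)\times\{j\}$. A solution is a function $z(t,j)$ defined on a hybrid time domain $\mathrm{dom}\,z$, such that $t\mapsto z(t,j)$ is locally absolutely continuous on $I_j=\{t:(t,j)\in\mathrm{dom}\,z\}$ for each $j$, $z(0,0)\in C\cup D$, and: (a) for each $j$ such that $I_j$ has nonempty interior, $\dot z(t,j)=f(z(t,j))$ for a.e. $t\in I_j$ and $z(t,j)\in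 C$ for all $t\in[\min I_j,\sup I_j)$; (b) for each $(t,j)\in\mathrm{dom}\,z$ with $(t,j+1)\in\mathrm{dom}\,z$, $z(t,j)\in D$ and $z(t,j+1)=g(z(t,j))$. A solution is complete if $\mathrm{dom}\,z$ is unbounded; for every initial condition in $X_0$ a complete solution exists and is unique. *)

(* Defs.v *)
From HB Require Import structures.
From mathcomp Require Import all_boot all_order all_algebra.
From mathcomp Require Import all_classical all_reals all_analysis.

Set Implicit Arguments.
Unset Strict Implicit.
Unset Printing Implicit Defensive.

Import Order.TTheory GRing.Theory Num.Theory.
Import numFieldNormedType.Exports.

Local Open Scope classical_set_scope.
Local Open Scope ring_scope.

(* [`| _ |] on matrices is the sup norm in the library, hence [norm2]. *)
Definition norm2 (R : realType) (n : nat) (v : 'cV[R]_n) : R :=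
  Num.sqrt (\sum_i v i 0 ^+ 2).

Definition opnorm2 (R : realType) (m n : nat) (M : 'M[R]_(m, n)) : R :=
  sup [set norm2 (M *m v) | v in [set v : 'cV[R]_n | norm2 v <= 1]].

(* The edge [edge j i] from [j] to [i] carries the weight [adj i j]. *)
Record wdigraph (R : realType) (N : nat) := WDigraph {
  edge : rel 'I_N;
  adj : 'M[R]_N;
  edge_irrefl : irreflexive edge;
  adj_edge : forall i j, edge j i -> 0 < adj i j;
  adj_nonedge : forall i j, ~~ edge j i -> adj i j = 0 }.

Section Graphs.
Variables (R : realType) (N : nat).

Definition weight_balanced (G : wdigraph R N) : Prop :=
  forall i, \sum_j adj G i j = \sum_j adj G j i.

Definition weakly_connected (G : wdigraph R N) : Prop :=
  forall i j, connect (fun k l => edge G k l || edge G l k) i j.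

Definition laplacian (G : wdigraph R N) : 'M[R]_N :=
  diag_mx (adj G *m const_mx 1 : 'cV[R]_N)^T - adj G.

Definition Sym (M : 'M[R]_N) : 'M[R]_N := 2^-1 *: (M + M^T).

(* The smallest nonzero eigenvalue: a matrix has finitely many eigenvalues,
   so the infimum is a minimum as soon as there is a nonzero one. *)
Definition lambda2 (M : 'M[R]_N) : R :=
  inf [set a : R | eigenvalue M a /\ a != 0].

End Graphs.

Section AbsoluteContinuity.
Variables (R : realType) (V : normedModType R).

Definition abs_cont_itv (a b : R) (f : R -> V) : Prop :=
  forall e : R, 0 < e -> exists2 d : R, 0 < d &
    forall (n : nat) (u v : 'I_n -> R),
      (forall i, a <= u i /\ u i <= v i /\ v i <= b) ->
      trivIset setT (fun i => `]u i, v i[%classic) ->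
      \sum_i (v i - u i) < d ->
      \sum_i `|f (v i) - f (u i)| < e.

Definition loc_abs_cont (I : set R) (f : R -> V) : Prop :=
  forall a b : R, `[a, b]%classic `<=` I -> abs_cont_itv a b f.

End AbsoluteContinuity.

Section HybridSystems.
Variable R : realType.

(* [t] is a whole sequence also for finitely many intervals; its terms after
   the end of the last interval, of index [J], play no role. *)
Definition hybrid_time_domain (E : set (R * nat)) : Prop :=
  exists t : nat -> R, [/\ t 0%N = 0, forall j, t j <= t j.+1 &
    E = \bigcup_j (`[t j, t j.+1]%classic `*` [set j]) \/
    exists (J : nat) (I : set R),
      [\/ I = `[t J, t J.+1]%classic,
          I = `[t J, t J.+1[%classic |
          I = `[t J, +oo[%classic] /\
      E = (\bigcup_(j in `I_J) (`[t j, t j.+1]%classic `*` [set j]))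
          `|` (I `*` [set J])].

Definition slice (E : set (R * nat)) (j : nat) : set R := [set t | E (t, j)].

Variables (S : normedModType R) (X C D : set S) (f g : S -> S).

(* [z] is total, but only its values on the domain [E] matter: the derivative
   at an interior point of [slice E j] does not depend on the values taken
   outside, and the endpoints are negligible.  [slice E j] being an interval,
   its points [t] with [t < sup] are those of [[min, sup)]; the supremum is
   taken in [\bar R] because the interval may be unbounded. *)
Definition hybrid_solution (E : set (R * nat)) (z : R -> nat -> S) : Prop :=
  [/\ hybrid_time_domain E,
      forall t j, E (t, j) -> X (z t j),
      (forall j, loc_abs_cont (slice E j) (z ^~ j)) /\ (C `|` D) (z 0 0%N),
      forall j, (slice E j)° !=set0 ->
        {ae lebesgue_measure, forall t : R, slice E j t ->
           is_derive t (1 : R) (z ^~ j) (f (z t j))} /\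
        (forall t, slice E j t ->
           (t%:E < ereal_sup [set s%:E | s in slice E j])%E -> C (z t j)) &
      forall t j, E (t, j) -> E (t, j.+1) ->
        D (z t j) /\ z t j.+1 = g (z t j)].

Definition complete_domain (E : set (R * nat)) : Prop :=
  ~ exists M : R, forall t j, E (t, j) -> t <= M /\ j%:R <= M.

End HybridSystems.

Notation state R N := ('cV[R]_N * 'cV[R]_N)%type.

Section HystereticQuantizers.
Variables (R : realType) (N : nat) (Delta : R) (L : 'M[R]_N).

Definition quanta : set R :=
  [set r | exists k : int, r = Delta * k%:~R \/ r = Delta * k%:~R + Delta / 2].

Definition stateset : set (state R N) := [set z : state R N | forall i, quanta (z.2 i 0)].

Definition flowset : set (state R N) :=
  stateset `&` [set z : state R N | forall i,
    z.2 i 0 - Delta / 2 < z.1 i 0 /\ z.1 i 0 < z.2 i 0 + Delta / 2].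

Definition jumpset : set (state R N) := stateset `\` flowset.

Definition initset : set (state R N) :=
  stateset `&` [set z : state R N | forall i,
    z.2 i 0 - Delta / 2 <= z.1 i 0 /\ z.1 i 0 < z.2 i 0 + Delta / 2].

Definition flowmap (z : state R N) : state R N := (- (L *m z.2), 0).

Definition jumpmap (z : state R N) : state R N :=
  (z.1, \col_i (if z.2 i 0 + Delta / 2 <= z.1 i 0 then z.2 i 0 + Delta / 2
                else if z.1 i 0 <= z.2 i 0 - Delta / 2 then z.2 i 0 - Delta / 2
                else z.2 i 0)).

Definition consensus_solution (E : set (R * nat)) (z : R -> nat -> state R N)
    : Prop :=
  hybrid_solution stateset flowset jumpset flowmap jumpmap E z.

End HystereticQuantizers.

(* Main.v *)
(* The squared norm of the disagreement y = x - mean is a Lyapunov function.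
   While flowing, |q_i - x_i| <= Delta / 2 for every i, and
   y . L q >= lambda2 |y|^2 - ||L|| |q - x| |y|, so |y|^2 decreases at a rate
   bounded below as long as |y| exceeds the claimed radius; jumps do not change
   x.  The quantized state is constant along a flow, so x is affine there: an
   absolutely continuous function whose derivative is almost everywhere equal
   to a constant is affine.  The minimum of the Rayleigh quotient of Sym L on
   the orthogonal complement of the vector of ones is lambda2, and it is
   positive by weak connectivity. *)
Require Import Defs.
From mathcomp Require Import all_boot all_order all_algebra.
From mathcomp Require Import all_classical all_reals all_analysis.
From mathcomp Require Import measurable_realfun.
From mathcomp Require Import ring lra.

Set Implicit Arguments.
Unset Strict Implicit.
Unset Printing Implicit Defensive.

Import Order.TTheory GRing.Theory Num.Theory.
Import numFieldNormedType.Exports.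

Local Open Scope classical_set_scope.
Local Open Scope ring_scope.

(** * Euclidean inner product, norm and operator norm *)

Definition dot (R : realType) (n : nat) (u v : 'cV[R]_n) : R :=
  (u^T *m v) 0 0.

Section Dot.
Context {R : realType} {n : nat}.
Implicit Types (u v w : 'cV[R]_n) (a : R).

Lemma dotE u v : dot u v = \sum_i u i 0 * v i 0.
Proof. by rewrite /dot mxE; apply: eq_bigr => i _; rewrite mxE. Qed.

Lemma dotC u v : dot u v = dot v u.
Proof. by rewrite !dotE; apply: eq_bigr => i _; rewrite mulrC. Qed.

Lemma dotDr u v w : dot u (v + w) = dot u v + dot u w.
Proof. by rewrite /dot mulmxDr mxE. Qed.

Lemma dotDl u v w : dot (u + v) w = dot u w + dot v w.
Proof. by rewrite dotC dotDr !(dotC w). Qed.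

Lemma dotZr a u v : dot u (a *: v) = a * dot u v.
Proof. by rewrite /dot -scalemxAr mxE. Qed.

Lemma dotZl a u v : dot (a *: u) v = a * dot u v.
Proof. by rewrite dotC dotZr dotC. Qed.

Lemma dotNr u v : dot u (- v) = - dot u v.
Proof. by rewrite -scaleN1r dotZr mulN1r. Qed.

Lemma dotBr u v w : dot u (v - w) = dot u v - dot u w.
Proof. by rewrite dotDr dotNr. Qed.

Lemma dot_delta u i : dot u (delta_mx i 0) = u i 0.
Proof.
rewrite dotE (bigD1 i)//= big1 => [|j ji]; first by rewrite mxE !eqxx mulr1 addr0.
by rewrite mxE (negbTE ji) mulr0.
Qed.

Lemma dot_ge0 u : 0 <= dot u u.
Proof. by rewrite dotE; apply: sumr_ge0 => i _; rewrite -expr2 sqr_ge0. Qed.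

Lemma dot_eq0 u : dot u u = 0 -> u = 0.
Proof.
rewrite dotE => /eqP; rewrite psumr_eq0; last first.
  by move=> i _; rewrite -expr2 sqr_ge0.
move=> /allP h; apply/colP => i; apply/eqP; rewrite mxE.
by have := h i (mem_index_enum i); rewrite /= mulf_eq0 orbb.
Qed.

Lemma dot_gt0 u : u != 0 -> 0 < dot u u.
Proof.
by move=> u0; rewrite lt_def dot_ge0 andbT; apply: contra u0 => /eqP/dot_eq0 ->.
Qed.

Lemma dot_mulmx (M : 'M[R]_n) u v : dot u (M *m v) = dot (M^T *m u) v.
Proof. by rewrite /dot trmx_mul trmxK mulmxA. Qed.

Lemma norm2E u : norm2 u = Num.sqrt (dot u u).
Proof.
by rewrite /norm2 dotE; congr Num.sqrt; apply: eq_bigr => i _; rewrite expr2.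
Qed.

Lemma norm2_ge0 u : 0 <= norm2 u.
Proof. exact: sqrtr_ge0. Qed.

Lemma sqr_norm2 u : norm2 u ^+ 2 = dot u u.
Proof. by rewrite norm2E sqr_sqrtr// dot_ge0. Qed.

Lemma norm2_gt0 u : u != 0 -> 0 < norm2 u.
Proof. by move=> u0; rewrite norm2E sqrtr_gt0 dot_gt0. Qed.

Lemma norm20 : norm2 (0 : 'cV[R]_n) = 0.
Proof. by rewrite norm2E /dot mulmx0 mxE sqrtr0. Qed.

Lemma norm2Z a u : norm2 (a *: u) = `|a| * norm2 u.
Proof.
by rewrite !norm2E dotZl dotZr mulrA -expr2 sqrtrM ?sqr_ge0// sqrtr_sqr.
Qed.

Lemma dot_le_norm2 u v : `|dot u v| <= norm2 u * norm2 v.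
Proof.
rewrite -ler_sqr ?nnegrE ?mulr_ge0 ?norm2_ge0//.
rewrite exprMn !sqr_norm2 real_normK ?num_real//.
have [->|/dot_gt0 v0] := eqVneq v 0; first by rewrite /dot !mulmx0 mxE expr0n mulr0.
(* Cauchy-Schwarz: the square of this vector is [dot v v] times the Gram determinant of [u] and
   [v]. *)
have := dot_ge0 (dot v v *: u - dot u v *: v).
rewrite -scaleNr dotDl !dotDr !dotZl !dotZr (dotC v u).
set a := dot u u; set b := dot v v; set c := dot u v => h.
have {h} : 0 <= b * (a * b - c ^+ 2) by apply: le_trans h _; lra.
by rewrite pmulr_rge0// subr_ge0.
Qed.

Lemma norm2_le_coord u a : 0 <= a -> (forall i, `|u i 0| <= a) ->
  norm2 u <= a * Num.sqrt n%:R.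
Proof.
move=> a0 ua.
rewrite -ler_sqr ?nnegrE ?mulr_ge0 ?norm2_ge0 ?sqrtr_ge0//.
rewrite sqr_norm2 dotE exprMn.
rewrite sqr_sqrtr ?ler0n//.
have -> : a ^+ 2 * n%:R = \sum_(i < n) a ^+ 2.
  by rewrite sumr_const card_ord mulr_natr.
apply: ler_sum => i _; rewrite -expr2 -real_normK ?num_real// ler_sqr ?nnegrE//.
Qed.

(** A crude bound from Cauchy-Schwarz on each row; it makes the supremum in [opnorm2] a genuine
    upper bound. *)
Lemma norm2_mulmx_bounded (M : 'M[R]_n) :
  has_ubound [set norm2 (M *m v) | v in [set v : 'cV[R]_n | norm2 v <= 1]].
Proof.
exists (\sum_i norm2 (row i M)^T * Num.sqrt n%:R) => _ [v /= v1 <-].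
rewrite -mulr_suml; apply: norm2_le_coord.
  by apply: sumr_ge0 => i _; exact: norm2_ge0.
move=> i; have -> : (M *m v) i 0 = dot (row i M)^T v.
  by rewrite dotE mxE; apply: eq_bigr => j _; rewrite !mxE.
apply: le_trans (dot_le_norm2 _ _) _.
rewrite (bigD1 i)//= -[leLHS]addr0; apply: lerD.
  by rewrite ler_piMr ?norm2_ge0.
by apply: sumr_ge0 => j _; exact: norm2_ge0.
Qed.

Lemma norm2_mulmx_le (M : 'M[R]_n) v : norm2 (M *m v) <= opnorm2 M * norm2 v.
Proof.
have [->|v0] := eqVneq v 0; first by rewrite mulmx0 !norm20 mulr0.
have vp := norm2_gt0 v0.
rewrite -ler_pdivrMr// /opnorm2; apply: ub_le_sup; first exact: norm2_mulmx_bounded.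
exists ((norm2 v)^-1 *: v); rewrite /= ?norm2Z ?ger0_norm ?invr_ge0 ?norm2_ge0//.
  by rewrite mulVf ?gt_eqF.
by rewrite -scalemxAr norm2Z ger0_norm ?invr_ge0 ?norm2_ge0// mulrC.
Qed.

Lemma opnorm2_ge0 (M : 'M[R]_n) : 0 <= opnorm2 M.
Proof.
rewrite /opnorm2; apply: ub_le_sup; first exact: norm2_mulmx_bounded.
by exists 0; rewrite /= ?mulmx0 norm20.
Qed.

End Dot.

(** * Laplacian of a weight-balanced graph *)

Section Laplacian.
Context {R : realType} {N : nat} (G : wdigraph R N).
Local Notation L := (laplacian G).
Local Notation A := (adj G).

Lemma adj_ge0 i j : 0 <= A i j.
Proof.
have [e|/adj_nonedge->//] := boolP (edge G j i).
by rewrite ltW// adj_edge.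
Qed.

Lemma laplacian_mulE (v : 'cV[R]_N) i :
  (L *m v) i 0 = \sum_j A i j * (v i 0 - v j 0).
Proof.
rewrite /laplacian mulmxBl mxE mul_diag_mx !mxE.
rewrite mulr_suml -sumrB; apply: eq_bigr => j _.
by rewrite mxE mulr1 mulrBr.
Qed.

Lemma laplacian_mul_const (a : R) : L *m (const_mx a : 'cV[R]_N) = 0.
Proof.
apply/colP => i; rewrite laplacian_mulE [RHS]mxE big1// => j _.
by rewrite !mxE subrr mulr0.
Qed.

Hypothesis balG : weight_balanced G.

(** Once the double sum is split, [f i] is multiplied by a row sum in one part and by a column sum
    in the other; balance equates them. *)
Lemma balanced_sum (f : 'I_N -> R) :
  \sum_i \sum_j A i j * (f i - f j) = 0.
Proof.
under eq_bigr do under eq_bigr do rewrite mulrBr.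
under eq_bigr do rewrite sumrB.
rewrite sumrB [X in _ - X]exchange_big/=.
apply/eqP; rewrite subr_eq0; apply/eqP; apply: eq_bigr => i _.
by rewrite -!mulr_suml balG.
Qed.

(** The vector of ones is a left null vector of [L], so the flow conserves the mean of [x]. *)
Lemma dot_const_laplacian (a : R) (v : 'cV[R]_N) :
  dot (const_mx a) (L *m v) = 0.
Proof.
rewrite dotE; under eq_bigr do rewrite laplacian_mulE mxE.
by rewrite -mulr_sumr balanced_sum mulr0.
Qed.

Lemma dot_laplacian (v : 'cV[R]_N) :
  dot v (L *m v) = 2^-1 * \sum_i \sum_j A i j * (v i 0 - v j 0) ^+ 2.
Proof.
suff : 2 * dot v (L *m v) - \sum_i \sum_j A i j * (v i 0 - v j 0) ^+ 2 = 0.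
  by move=> ?; lra.
(* Termwise, [2 v_i (v_i - v_j) - (v_i - v_j)^2 = v_i^2 - v_j^2]. *)
rewrite -[RHS](balanced_sum (fun i => v i 0 ^+ 2)) dotE mulr_sumr -sumrB.
apply: eq_bigr => i _; rewrite laplacian_mulE !mulr_sumr -sumrB.
by apply: eq_bigr => j _; ring.
Qed.

Lemma dot_laplacian_ge0 (v : 'cV[R]_N) : 0 <= dot v (L *m v).
Proof.
rewrite dot_laplacian mulr_ge0 ?invr_ge0//.
apply: sumr_ge0 => i _; apply: sumr_ge0 => j _.
by rewrite mulr_ge0 ?adj_ge0 ?sqr_ge0.
Qed.

Lemma dot_laplacian_eq0 (v : 'cV[R]_N) : weakly_connected G ->
  dot v (L *m v) = 0 -> forall i j, v i 0 = v j 0.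
Proof.
move=> conG /eqP; rewrite dot_laplacian mulf_eq0 invr_eq0 pnatr_eq0/=.
rewrite psumr_eq0 => [|i _]; last first.
  by apply: sumr_ge0 => j _; rewrite mulr_ge0 ?adj_ge0 ?sqr_ge0.
move=> /allP h.
have vE k l : edge G k l -> v l 0 = v k 0.
  move=> kl; have := h l (mem_index_enum l).
  rewrite psumr_eq0 => [|j _]; last by rewrite mulr_ge0 ?adj_ge0 ?sqr_ge0.
  move=> /allP/(_ k (mem_index_enum k)).
  by rewrite mulf_eq0 gt_eqF ?adj_edge//= sqrf_eq0 subr_eq0 => /eqP.
(* The level set of [v] through [i] is closed under adjacency in both directions, so it contains
   [j]. *)
move=> i j; have /closed_connect := conG i j.
move=> /(_ [pred k | v k 0 == v i 0]); rewrite !inE eqxx => /(_ _)/esym/eqP -> //.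
by move=> k l /orP[] /vE; rewrite !inE => ->.
Qed.

Lemma dot_Sym (M : 'M[R]_N) (v : 'cV[R]_N) :
  dot v (Sym M *m v) = dot v (M *m v).
Proof.
rewrite /Sym -scalemxAl mulmxDl dotZr dotDr (dot_mulmx M^T) trmxK.
by rewrite (dotC (M *m v)); lra.
Qed.

Lemma trmx_Sym (M : 'M[R]_N) : (Sym M)^T = Sym M.
Proof. by rewrite /Sym linearZ linearD/= trmxK addrC. Qed.

Lemma Sym_laplacian_const (a : R) : Sym L *m (const_mx a : 'cV[R]_N) = 0.
Proof.
rewrite /Sym -scalemxAl mulmxDl laplacian_mul_const add0r.
have -> : L^T *m (const_mx a : 'cV[R]_N) = 0.
  (* With [w = L^T *m const_mx a], [dot w w] equals [dot (const_mx a) (L *m w)], which vanishes by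
     balance. *)
  by apply: dot_eq0; rewrite -dot_mulmx dot_const_laplacian.
by rewrite scaler0.
Qed.

End Laplacian.

(** * Minimum of a Rayleigh quotient under an orthogonality constraint *)

Section RayleighMinimum.
Context {R : realType} {n : nat}.

Lemma continuous_dot_mulmx (M : 'M[R]_n) :
  continuous (fun r : 'rV[R]_n => dot r^T (M *m r^T)).
Proof.
have -> : (fun r : 'rV[R]_n => dot r^T (M *m r^T)) =
    (fun r => \sum_(i < n) r 0 i * \sum_(j < n) M i j * r 0 j).
  apply/funext => r; rewrite dotE; apply: eq_bigr => i _; rewrite !mxE.
  by congr (_ * _); apply: eq_bigr => j _; rewrite !mxE.
apply: (continuous_big add_continuous) => i _ r.
apply: continuousM; first exact: coord_continuous.
apply: (continuous_big add_continuous) => j _ {}r.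
apply: continuousM; first exact: cst_continuous.
exact: coord_continuous.
Qed.

Lemma continuous_dotl (u : 'cV[R]_n) :
  continuous (fun r : 'rV[R]_n => dot u r^T).
Proof.
have -> : (fun r : 'rV[R]_n => dot u r^T) =
    (fun r => \sum_(i < n) u i 0 * r 0 i).
  by apply/funext => r; rewrite dotE; apply: eq_bigr => i _; rewrite !mxE.
apply: (continuous_big add_continuous) => i _ r.
apply: continuousM; first exact: cst_continuous.
exact: coord_continuous.
Qed.

(** Heine-Borel: unit Euclidean length bounds every coordinate by 1, and both equations are closed
    conditions. Vectors are rows to match [bounded_closed_compact]. *)
Lemma compact_sphere_orth (u : 'cV[R]_n) :
  compact [set r : 'rV[R]_n | dot r^T r^T = 1 /\ dot u r^T = 0].
Proof.
apply: bounded_closed_compact.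
  exists 1; split => // M M1 r /= [r1 _]; apply: le_trans (ltW M1).
  rewrite [leLHS]/Num.norm /= mx_normrE; apply/bigmax_leP; split => //= -[i j] _ /=.
  rewrite (ord1 i) -(@ler_pXn2r _ 2)// ?nnegrE//= expr1n real_normK ?num_real//.
  rewrite -r1 dotE (bigD1 j)//= !mxE -expr2 lerDl.
  by apply: sumr_ge0 => k _; rewrite mxE -expr2 sqr_ge0.
have -> : [set r : 'rV[R]_n | dot r^T r^T = 1 /\ dot u r^T = 0] =
   (fun r : 'rV[R]_n => dot r^T (1%:M *m r^T)) @^-1` [set 1] `&`
   (fun r : 'rV[R]_n => dot u r^T) @^-1` [set 0].
  by apply/seteqP; split => r /=; rewrite mul1mx.
apply: closedI; apply: preimage_closed.
- by move=> *; exact: continuous_dot_mulmx.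
- exact: closed_eq.
- by move=> *; exact: continuous_dotl.
- exact: closed_eq.
Qed.

(** The quadratic form attains its minimum on a compact sphere. As [u] lies in the kernel of the
    symmetric [S], its orthogonal complement is invariant, so the residual [S *m v - mu *: v] is an
    admissible direction and optimality forces it to vanish. *)
Lemma sym_min_eigenvector (S : 'M[R]_n) (u : 'cV[R]_n) :
  S^T = S -> S *m u = 0 -> (exists2 w, w != 0 & dot u w = 0) ->
  exists (mu : R) (v : 'cV[R]_n),
    [/\ v != 0, dot u v = 0, S *m v = mu *: v &
        forall w, dot u w = 0 -> mu * dot w w <= dot w (S *m w)].
Proof.
move=> symS Su [w0 w00 uw0].
pose K := [set r : 'rV[R]_n | dot r^T r^T = 1 /\ dot u r^T = 0].
have normalize w : w != 0 -> dot u w = 0 -> K ((norm2 w)^-1 *: w)^T.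
  move=> w_neq0 uw; rewrite /K /= trmxK; split; last by rewrite dotZr uw mulr0.
  rewrite dotZr dotZl -sqr_norm2 expr2; field.
  by rewrite gt_eqF// norm2_gt0.
have K0 : K !=set0 by eexists; exact: normalize w00 uw0.
have [r] := compact_EVT_min K0 (@compact_sphere_orth u)
  (continuous_subspaceT (@continuous_dot_mulmx S)).
rewrite inE => -[r1 ur] minr.
set v := r^T in r1 ur minr; pose mu := dot v (S *m v).
have min w : dot u w = 0 -> mu * dot w w <= dot w (S *m w).
  move=> uw; have [->|w_neq0] := eqVneq w 0.
    by rewrite /dot mulmx0 !mulmx0 mxE mulr0.
  have /mem_set/minr := normalize _ w_neq0 uw.
  rewrite trmxK -/mu dotZl -scalemxAr dotZr => h.
  rewrite -sqr_norm2 -ler_pdivlMr ?exprn_gt0 ?norm2_gt0//.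
  by apply: le_trans h _; rewrite expr2 invfM [leRHS]mulrC mulrA.
exists mu, v; split => //.
  by apply: contra_eqN r1 => /eqP ->; rewrite /dot mulmx0 mxE eq_sym oner_eq0.
(* First-order optimality in the direction of the residual [w]. *)
pose w := S *m v - mu *: v.
have uw : dot u w = 0.
  by rewrite dotBr dotZr ur mulr0 subr0 dot_mulmx symS Su /dot trmx0 mul0mx mxE.
have vw : dot v w = 0 by rewrite dotBr dotZr r1 mulr1 subrr.
have wSv : dot w (S *m v) = dot w w.
  by rewrite -[in RHS]/w {2}/w dotBr dotZr (dotC w v) vw mulr0 subr0.
suff /dot_eq0/eqP : dot w w = 0 by rewrite subr_eq0 => /eqP.
clearbody w; pose b := dot w w; pose q := dot w (S *m w) - mu * dot w w.
have b0 : 0 <= b by exact: dot_ge0.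
have q0 : 0 <= q by rewrite subr_ge0 min.
(* Perturbing [v] by [s *: w] gives [0 <= 2 s b + s^2 q]. The choice [s = - b / (q + 1)] makes the
   right side negative unless [b = 0]; the added 1 covers [q = 0]. *)
have /min : dot u (v + (- b / (q + 1)) *: w) = 0.
  by rewrite dotDr dotZr ur uw mulr0 addr0.
set s := - b / (q + 1).
rewrite mulmxDr -scalemxAr !dotDl !dotDr !dotZl !dotZr r1 -/mu vw (dotC w v) vw.
rewrite (dot_mulmx S v) symS (dotC (S *m v)) wSv -/b.
have -> : dot w (S *m w) = q + mu * b by rewrite /q subrK.
move=> h; have {h} : 0 <= 2 * s * b + s ^+ 2 * q by lra.
have -> : 2 * s * b + s ^+ 2 * q = - (b ^+ 2 * (q + 2) / (q + 1) ^+ 2).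
  by rewrite /s; field; rewrite gt_eqF// ltr_wpDl.
rewrite oppr_ge0 pmulr_lle0 ?invr_gt0 ?exprn_gt0 ?ltr_wpDl//.
rewrite pmulr_lle0 ?ltr_wpDl// => h.
have : b ^+ 2 == 0 by rewrite eq_le h sqr_ge0.
by rewrite sqrf_eq0 => /eqP.
Qed.

End RayleighMinimum.

(** * Algebraic connectivity *)

Section AlgebraicConnectivity.
Context {R : realType} {N : nat} (G : wdigraph R N).
Hypotheses (N2 : (2 <= N)%N) (conG : weakly_connected G)
  (balG : weight_balanced G).
Local Notation L := (laplacian G).
Local Notation one := (const_mx 1 : 'cV[R]_N).

Lemma dot_one_orth : exists2 w : 'cV[R]_N, w != 0 & dot one w = 0.
Proof.
pose i0 := Ordinal (ltnW N2); pose i1 := Ordinal N2.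
exists (delta_mx i0 0 - delta_mx i1 0).
  by apply/eqP => /colP/(_ i0); rewrite !mxE/= subr0 => /eqP; rewrite oner_eq0.
by rewrite dotBr !dot_delta !mxE subrr.
Qed.

(** The constrained minimum [mu] is nonzero, since otherwise its eigenvector would be constant as
    well as orthogonal to the ones. Eigenvectors for any nonzero eigenvalue are orthogonal to the
    ones, so [mu] is the least such eigenvalue. *)
Lemma lambda2_Rayleigh :
  0 < lambda2 (Sym L) /\
  forall w, dot one w = 0 -> lambda2 (Sym L) * dot w w <= dot w (L *m w).
Proof.
have [mu [v [v0 onev Sv min]]] :=
  sym_min_eigenvector (trmx_Sym L) (Sym_laplacian_const balG 1) dot_one_orth.
have muE : mu * dot v v = dot v (L *m v) by rewrite -dot_Sym Sv dotZr.
have mu_ge0 : 0 <= mu.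
  by rewrite -(pmulr_lge0 _ (dot_gt0 v0)) muE dot_laplacian_ge0.
have mu_neq0 : mu != 0.
  apply: contraNN v0 => /eqP mu0; move: muE.
  rewrite mu0 mul0r => /esym/(dot_laplacian_eq0 balG conG) vE.
  pose i0 := Ordinal (ltnW N2).
  have vc : v = v i0 0 *: one by apply/colP => i; rewrite !mxE mulr1.
  by apply/eqP/dot_eq0; rewrite {1}vc dotZl onev mulr0.
have lbmu a : eigenvalue (Sym L) a -> a != 0 -> mu <= a.
  move=> /eigenvalueP[r rS r0] a0.
  (* [eigenvalue] speaks of row vectors; symmetry allows transposing. *)
  have rS' : Sym L *m r^T = a *: r^T by rewrite -{1}trmx_Sym -trmx_mul rS linearZ.
  have r0' : r^T != 0 by rewrite trmx_eq0.
  have oner : dot one r^T = 0.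
    apply/eqP; rewrite -(mulrI_eq0 _ (mulfI a0)) -dotZr -rS' dot_mulmx trmx_Sym.
    by rewrite Sym_laplacian_const// /dot trmx0 mul0mx mxE.
  by have := min _ oner; rewrite rS' dotZr ler_pM2r// dot_gt0.
have evmu : eigenvalue (Sym L) mu.
  apply/eigenvalueP; exists v^T; last by rewrite trmx_eq0.
  by rewrite -[Sym L]trmx_Sym -trmx_mul Sv linearZ.
have -> : lambda2 (Sym L) = mu.
  apply/eqP; rewrite eq_le; apply/andP; split.
    by apply: ge_inf; [exists 0|] => //= a [/lbmu/[apply]]; exact: le_trans.
  by apply: lb_le_inf; [exists mu|] => //= a [/lbmu/[apply]].
split=> [|w /min]; first by rewrite lt_def mu_neq0.
by rewrite dot_Sym.
Qed.

(** Otherwise [L] would kill a nonzero vector orthogonal to the ones, against the Rayleigh bound.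
    This makes the radius of the limit ball positive. *)
Lemma opnorm2_laplacian_gt0 : 0 < opnorm2 L.
Proof.
rewrite lt_def opnorm2_ge0 andbT; apply/eqP => L0.
have [lam0 min] := lambda2_Rayleigh; have [w w0 /min] := dot_one_orth.
have -> : L *m w = 0.
  apply/dot_eq0; rewrite -sqr_norm2.
  have := norm2_mulmx_le L w; rewrite L0 mul0r => h.
  have /eqP -> : norm2 (L *m w) == 0 by rewrite eq_le h norm2_ge0.
  by rewrite expr0n.
by apply/negP; rewrite -ltNge {1}/dot mulmx0 mxE mulr_gt0// dot_gt0.
Qed.

End AlgebraicConnectivity.

(** * Absolutely continuous functions with almost everywhere constant derivative *)

Section AbsolutelyContinuousAffine.
Context {R : realType}.
Local Notation mu := (@lebesgue_measure R).

(** Real induction: the supremum of the points satisfying [P] is approached from the left by such a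
    point, and the step carries [P] across it. *)
Lemma interval_induction (a b : R) (P : R -> Prop) : a <= b -> P a ->
  (forall x, a <= x <= b -> exists2 d : R, 0 < d &
    forall u v, a <= u -> u <= x -> x <= v -> v <= b -> x - d < u -> v < x + d ->
      P u -> P v) ->
  P b.
Proof.
move=> ab Pa step.
pose A := [set s | a <= s <= b /\ P s].
have Aa : A a by split=> //; rewrite lexx.
have ubA : ubound A b by move=> s [/andP[]].
have supA : has_sup A by split; [exists a | exists b].
have xb : sup A <= b by apply: ge_sup => //; exists a.
have ax : a <= sup A by apply: ub_le_sup => //; exists b.
have [|d d0 {}step] := step (sup A); first by rewrite ax xb.
have [u [/andP[au ub] Pu] ux] := sup_adherent d0 supA.
have ux' : u <= sup A by apply: ub_le_sup; [exists b | split=> //; rewrite au ub].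
(* A point past the supremum unless cut off at [b]; as [P v] holds, it must be [b]. *)
pose v := Num.min b (sup A + d / 2).
have xv : sup A <= v by rewrite le_min xb/= lerDl divr_ge0// ltW.
have vb : v <= b by rewrite ge_min lexx.
have vd : v < sup A + d by rewrite gt_min ltrD2l ltr_pdivrMr// ltr_pMr// ltr1n orbT.
have Pv : P v := step u v au ux' xv vb ux vd Pu.
suff <- : v = b by [].
have vx : v <= sup A.
  by apply: ub_le_sup; [exists b | split=> //; rewrite vb (le_trans ax xv)].
move: vx; rewrite /v; case: (leP b (sup A + d / 2)) => // _.
by rewrite gerDl leNgt divr_gt0.
Qed.

Lemma is_derive_increment {V : normedModType R} (f : R -> V) x c (e : R) :
  is_derive x (1 : R) f c -> 0 < e ->
  exists2 d : R, 0 < d & forall y, `|y - x| < d ->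
    `|f y - f x - (y - x) *: c| <= e * `|y - x|.
Proof.
move=> [fx dfx] e0.
have : (fun h : R => h^-1 *: ((f \o shift x) (h *: (1 : R)) - f x)) @ 0^' --> c.
  by rewrite -dfx.
move=> /cvgrPdist_le/(_ e e0)[d /= d0 h]; exists d => // y yx.
have [->|yx0] := eqVneq y x; first by rewrite !subrr scale0r subrr !normr0 mulr0.
have yx_neq0 : y - x != 0 by rewrite subr_eq0.
have := h (y - x); rewrite /= sub0r normrN => /(_ yx yx_neq0).
rewrite /GRing.scale/= mulr1 subrK => {}h.
have -> : f y - f x - (y - x) *: c =
    - ((y - x) *: (c - (y - x)^-1 *: (f y - f x))).
  by rewrite scalerBr scalerA mulfV// scale1r opprB.
by rewrite normrN normrZ mulrC ler_wpM2r.
Qed.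

Let disjoint_chain : rel (R * R) := fun p q => p.2 <= q.1.

(** Lists are easy to extend at the right end during the induction; their ordering yields the
    disjointness required by absolute continuity. *)
Lemma abs_cont_seq {V : normedModType R} (f : R -> V) (a b e d : R) :
  (forall (n : nat) (u v : 'I_n -> R),
     (forall i, a <= u i /\ u i <= v i /\ v i <= b) ->
     trivIset setT (fun i => `]u i, v i[%classic) ->
     \sum_i (v i - u i) < d -> \sum_i `|f (v i) - f (u i)| < e) ->
  forall l : seq (R * R),
    all (fun p => [&& a <= p.1, p.1 <= p.2 & p.2 <= b]) l ->
    pairwise disjoint_chain l ->
    \sum_(p <- l) (p.2 - p.1) < d -> \sum_(p <- l) `|f p.2 - f p.1| < e.
Proof.
move=> ac l /allP labl /(pairwiseP (0, 0)) ordl.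
rewrite !(big_nth (0, 0)) !big_mkord; apply: ac.
  by move=> i; have /labl/and3P[] := mem_nth (0, 0) (ltn_ord i).
have disj (i j : 'I_(size l)) t : (i < j)%N ->
    `](nth (0, 0) l i).1, (nth (0, 0) l i).2[%classic t ->
    `](nth (0, 0) l j).1, (nth (0, 0) l j).2[%classic t -> False.
  move=> ij; rewrite /= !in_itv/= => /andP[_ t1] /andP[t2 _].
  have := ordl i j (ltn_ord i) (ltn_ord j) ij.
  by rewrite /disjoint_chain leNgt (lt_trans t2 t1).
move=> i j _ _ [t [ti tj]]; apply/val_inj.
case: (ltngtP i j) => // ij.
  by have := disj _ _ _ ij ti tj.
by have := disj _ _ _ ij tj ti.
Qed.

(* A partition argument: subintervals around exceptional points lie in an open
   set of small measure and are controlled by absolute continuity, the other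
   ones are controlled by the derivative at a tag. *)
Lemma abs_cont_affine {V : normedModType R} (f : R -> V) (a b : R) (c : V) :
  a <= b -> abs_cont_itv a b f ->
  {ae mu, forall t, a <= t <= b -> is_derive t (1 : R) f c} ->
  f b - f a = (b - a) *: c.
Proof.
move=> ab acf [N [mN muN0 subN]].
pose F u v := `|f v - f u - (v - u) *: c|.
(* One share of [e] per unit length comes from the differentiability points; the two extra shares
   pay for the listed intervals, one for the increments of [f] and one for those of the linear
   part. *)
suff small e : 0 < e -> F a b <= e * (b - a + 2).
  apply/eqP; rewrite -subr_eq0 -normr_le0; apply/ler_addgt0Pr => e e0.
  rewrite add0r; have ba0 : 0 < b - a + 2 by rewrite ltr_wpDl// subr_ge0.
  have := small (e / (b - a + 2)); rewrite divr_gt0// => /(_ isT).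
  by rewrite divfK// gt_eqF.
move=> e0; have [d d0 ac] := acf e e0.
have c1 : 0 < `|c| + 1 by rewrite ltr_wpDl.
pose eta := Num.min d (e / (`|c| + 1)).
have eta0 : 0 < eta by rewrite lt_min d0 divr_gt0.
have [|U [oU NU muU]] := lebesgue_regularity_outer mN _ eta0.
  by rewrite [X in (X < _)%E]muN0 ltry.
have mU : measurable U by exact: open_measurable.
have {}muU : (mu U < eta%:E)%E.
  apply: le_lt_trans muU; rewrite -[leRHS]adde0 -muN0.
  rewrite -[X in (mu X <= _)%E](setDKU NU) measureU2//.
  exact: measurableD.
(* The list holds the subintervals of [[a, s]] not controlled by a derivative; the measure of [U] up
   to [s] caps their total length. *)
pose P s := exists l : seq (R * R),
  [/\ all (fun p => [&& a <= p.1, p.1 <= p.2 & p.2 <= s]) l,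
      pairwise disjoint_chain l,
      ((\sum_(p <- l) (p.2 - p.1))%:E <= mu (U `&` `]a, s]))%E &
      F a s <= e * (s - a) + \sum_(p <- l) F p.1 p.2].
suff [l [labl ordl lU Fab]] : P b.
  have {lU} lU : \sum_(p <- l) (p.2 - p.1) < eta.
    rewrite -lte_fin; apply: le_lt_trans lU _; apply: le_lt_trans muU.
    by apply: le_measure; rewrite ?inE//; exact: measurableI.
  have le1 : \sum_(p <- l) `|f p.2 - f p.1| <= e.
    by apply/ltW/(abs_cont_seq ac) => //; apply: lt_le_trans lU _; rewrite ge_min lexx.
  have le2 : \sum_(p <- l) (p.2 - p.1) * `|c| <= e.
    rewrite -mulr_suml.
    apply: (@le_trans _ _ (e / (`|c| + 1) * `|c|)).
      by rewrite ler_wpM2r// ltW// (lt_le_trans lU)// ge_min lexx orbT.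
    by rewrite mulrAC ler_pdivrMr// ler_wpM2l ?ltW// ltrDl.
  apply: le_trans Fab _; rewrite [leRHS]mulrDr lerD2l mulr_natr mulr2n.
  apply: le_trans (lerD le1 le2); rewrite -big_split/=.
  rewrite big_seq [leRHS]big_seq; apply: ler_sum => p /(allP labl)/and3P[_ p12 _].
  apply: le_trans (ler_normB _ _) _.
  by rewrite lerD2l normrZ ger0_norm// subr_ge0.
have F_triangle u v w : F u w <= F u v + F v w.
  rewrite [leRHS]addrC; apply: le_trans (ler_normD _ _).
  rewrite le_eqVlt; apply/orP; left; apply/eqP.
  congr Num.norm; rewrite -(subrKA (f v) (f w)) -(subrKA v w).
  by rewrite scalerDl opprD addrACA.
apply: (interval_induction ab) => [|x /andP[ax xb]].
  exists [::]; split => //; rewrite big_nil ?measure_ge0//.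
  by rewrite /F !subrr scale0r subrr normr0 mulr0 addr0.
have [Ux|nUx] := pselect (U x).
  (* Near a point of [U], [[u, v]] joins the list: []u, v]] lies in [U], so the cap grows by exactly
     its length. *)
  have /nbhs_ballP[r /= r0 ball_r] : nbhs x U by exact: open_nbhs_nbhs.
  exists r => // u v au ux xv vb xru vxr [l [labl ordl lU Fau]].
  have uv : u <= v := le_trans ux xv.
  have uvU : `]u, v] `<=` U.
    move=> t /=; rewrite in_itv/= => /andP[ut tv]; apply: ball_r.
    rewrite /ball/= ltr_norml; apply/andP; split; lra.
  exists (rcons l (u, v)); split.
  - rewrite all_rcons/= au uv lexx/=; apply: sub_all labl => p /and3P[-> -> pu].
    exact: le_trans pu uv.
  - rewrite pairwise_rcons ordl andbT; apply: sub_all labl => p /and3P[_ _ pu].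
    exact: pu.
  - rewrite big_rcons/= EFinD.
    have -> : U `&` `]a, v] = (U `&` `]a, u]) `|` `]u, v].
      apply/seteqP; split=> [t [Ut]|t [[Ut]|tuv]] /=; rewrite ?in_itv/=.
      + move=> /andP[at_ tv]; case: (leP t u) => tu; [left|right] => //.
        by rewrite at_.
      + by move=> /andP[-> tu]; split => //; rewrite (le_trans tu uv).
      + split; first exact: uvU.
        move: tuv; rewrite /= in_itv/= => /andP[ut ->].
        by rewrite (le_lt_trans au ut).
    rewrite measureU//; last 2 first.
    + exact: measurableI.
    + apply/seteqP; split => // t [[_ /=]]; rewrite !in_itv/= => /andP[_ tu].
      by rewrite ltNge tu.
    rewrite leeD//= lebesgue_measure_itv/= lte_fin.
    case: ltP => [_|vu]; first by rewrite EFinB.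
    by rewrite lee_fin subr_le0.
  - rewrite big_rcons/=; apply: le_trans (F_triangle _ u _) _.
    rewrite addrA lerD2r; apply: le_trans Fau _.
    by rewrite lerD2r ler_pM2l// lerD2r.
(* Outside [U] the derivative at the tag [x] controls both [[u, x]] and [[x, v]], and the list is
   unchanged. *)
have dfx : is_derive x (1 : R) f c.
  apply: contrapT => ndfx; apply: nUx; apply: NU; apply: subN => /= h.
  by apply: ndfx; apply: h; rewrite ax xb.
have [r r0 incr] := is_derive_increment dfx e0.
exists r => // u v au ux xv vb xru vxr [l [labl ordl lU Fau]].
have uv : u <= v := le_trans ux xv.
exists l; split => //.
- apply: sub_all labl => p /and3P[-> -> pu].
  exact: le_trans pu uv.
- apply: le_trans lU _; apply: le_measure; rewrite ?inE; try exact: measurableI.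
  move=> t [Ut /=]; rewrite !in_itv/= => /andP[at_ tu]; split => //.
  by rewrite at_ (le_trans tu uv).
- have Fuv : F u v <= e * (v - u).
    have Fxv : F x v <= e * (v - x).
      have := incr v; rewrite ger0_norm ?subr_ge0//; apply; lra.
    have Fux : F u x <= e * (x - u).
      have -> : F u x = `|f u - f x - (u - x) *: c|.
        by rewrite /F -[RHS]normrN -(opprB x u) scaleNr opprK opprD opprB.
      have := incr u; rewrite distrC ger0_norm ?subr_ge0//; apply; lra.
    apply: le_trans (F_triangle u x v) _; apply: le_trans (lerD Fux Fxv) _.
    by rewrite -mulrDr ler_pM2l//; lra.
  apply: le_trans (F_triangle a u v) _; apply: le_trans (lerD Fau Fuv) _.
  by rewrite addrAC -mulrDr lerD2r ler_pM2l//; lra.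
Qed.

End AbsolutelyContinuousAffine.

(** * Projections, endpoint bounds and hybrid time domains *)

Section PairProjections.
Context {R : realType} {V W : normedModType R}.
Implicit Types f : R -> V * W.

Lemma is_derive_snd f x df : is_derive x (1 : R) f df ->
  is_derive x (1 : R) (fun t => (f t).2) df.2.
Proof.
move=> [fx dfx].
have lim_f :
    (fun h : R => h^-1 *: ((f \o shift x) (h *: (1 : R)) - f x)) @ 0^' --> df.
  by rewrite -dfx.
have lim_f2 : (fun h : R =>
      h^-1 *: (((fun t => (f t).2) \o shift x) (h *: (1 : R)) - (f x).2))
    @ 0^' --> df.2.
  have snd_df : (@snd V W) @ df --> df.2 by case: (df) => df1 df2; exact: cvg_snd.
  exact: cvg_comp lim_f snd_df.
by split; [exact: cvgP lim_f2 | exact/cvg_lim].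
Qed.

Lemma abs_cont_snd (a b : R) f : abs_cont_itv a b f ->
  abs_cont_itv a b (fun t => (f t).2).
Proof.
move=> acf e /acf[d d0 h]; exists d => // n u v uv tuv /(h n u v uv tuv).
apply: le_lt_trans; apply: ler_sum => i _.
by rewrite prod_normE/= le_max lexx orbT.
Qed.

End PairProjections.

(** Used at the end of a flow interval, where membership in the flow set may fail. *)
Lemma affine_half_open_le (R : realFieldType) (p q d : R) :
  (forall th, 0 <= th -> th < 1 -> p + th * (q - p) <= d) -> q <= d.
Proof.
move=> h; rewrite leNgt; apply/negP => dq.
have pd : p <= d by have := h 0 (lexx _) ltr01; rewrite mul0r addr0.
have qp : 0 < q - p by lra.
(* The parameter at which the affine function takes the value [(d + q) / 2], which would exceed
   [d]. *)
have := h (((d + q) / 2 - p) / (q - p)).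
rewrite divfK ?gt_eqF// ltr_pdivrMr// divr_ge0 ?(ltW qp)//; last by lra.
by move=> /(_ isT) {}h; have := h ltac:(lra); lra.
Qed.

(** Prepares the induction on the number of jumps: [s] is the start of the current flow interval,
    either the initial time or the time of the last jump. *)
Lemma hybrid_time_domain_slice (R : realType) (E : set (R * nat))
    (t : R) (j : nat) :
  hybrid_time_domain E -> E (t, j) ->
  exists s, [/\ s <= t, forall r, s <= r <= t -> E (r, j) &
    if j is k.+1 then E (s, k) else s = 0].
Proof.
move=> [tau [tau0 tau_le]] [->|[J [I [Idef ->]]]].
  move=> [i _ [/= + jk]]; rewrite -{}jk in_itv/= => /andP[jt tj].
  exists (tau j); split => //.
    move=> r /andP[jr rt]; exists j => //; split => //=.
    by rewrite in_itv/= jr (le_trans rt tj).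
  by case: j {jt tj} => // k; exists k => //; split => //=; rewrite in_itv/= tau_le lexx.
have before k : (k < J)%N ->
    (\bigcup_(j in `I_J) (`[tau j, tau j.+1]%classic `*` [set j])
     `|` (I `*` [set J])) (tau k.+1, k).
  by move=> kJ; left; exists k => //; split => //=; rewrite in_itv/= tau_le lexx.
move=> [[i /= kJ [/= + jk]]|[/= It jJ]].
  rewrite -{}jk in kJ *; rewrite in_itv/= => /andP[jt tj].
  exists (tau j); split => //.
    move=> r /andP[jr rt]; left; exists j => //; split => //=.
    by rewrite in_itv/= jr (le_trans rt tj).
  by case: j kJ {jt tj} => // k kJ; apply: before; exact: ltnW.
rewrite -{}jJ in Idef before *; exists (tau j); split.
- by case: Idef => IE; move: It; rewrite IE/= in_itv/= => /andP[].
- move=> r /andP[jr rt]; right; split => //=; move: It.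
  case: Idef => ->; rewrite /= !in_itv/= jr//= => /andP[_].
    exact: le_trans.
  exact: le_lt_trans.
- by case: j {Idef It} before => // k; exact.
Qed.

(** * Behaviour along one flow interval *)

Section Flow.
Context {R : realType} {N : nat} (Delta : R) (L : 'M[R]_N).
Context (E : set (R * nat)) (z : R -> nat -> state R N).
Hypothesis solz : consensus_solution Delta L E z.
Context (j : nat) (a b : R).
Hypotheses (ab : a < b) (abE : forall r, a <= r <= b -> E (r, j)).

Let slice_interior : (slice E j)° !=set0.
Proof.
exists ((a + b) / 2); rewrite /interior/=.
have : nbhs ((a + b) / 2) `]a, b[%classic.
  apply: open_nbhs_nbhs; split; first exact: interval_open.
  by rewrite /= in_itv/= !midf_lt.
apply: filterS => r /=; rewrite in_itv/= => /andP[ar rb].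
by apply: abE; rewrite !ltW.
Qed.

Let abs_cont_z s : a <= s <= b -> abs_cont_itv a s (z ^~ j).
Proof.
move=> /andP[as_ sb]; have [_ _ [ac _] _ _] := solz; apply: (ac j) => r /=.
by rewrite in_itv/= => /andP[ar rs]; apply: abE; rewrite ar (le_trans rs sb).
Qed.

(** Treated before the position: only once [q] is known to be constant is the velocity [- L q]
    constant. *)
Lemma flow_quantized s : a <= s <= b -> (z s j).2 = (z a j).2.
Proof.
move=> asb; have /andP[as_ sb] := asb.
apply/eqP; rewrite -subr_eq0; apply/eqP.
rewrite (abs_cont_affine as_ (abs_cont_snd (abs_cont_z asb)) (c := 0)) ?scaler0//.
have [_ _ _ flow _] := solz; have [+ _] := flow j slice_interior.
apply: filterS; first exact: (ae_filter_ringOfSetsType lebesgue_measure).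
move=> t /= dz /andP[at_ ts].
have /dz/is_derive_snd// : slice E j t by apply: abE; rewrite at_ (le_trans ts sb).
Qed.

Lemma flow_position s : a <= s <= b ->
  (z s j).1 = (z a j).1 - (s - a) *: (L *m (z a j).2).
Proof.
move=> asb; have /andP[as_ sb] := asb.
apply/eqP; rewrite -subr_eq0 opprB addrCA addrC addr_eq0; apply/eqP.
have := abs_cont_affine as_ (abs_cont_z asb) (c := (- (L *m (z a j).2), 0)).
move=> /(_ _)/(congr1 fst)/= -> //; first by rewrite scalerN.
have [_ _ _ flow _] := solz; have [+ _] := flow j slice_interior.
apply: filterS; first exact: (ae_filter_ringOfSetsType lebesgue_measure).
move=> t /= dz /andP[at_ ts].
have atb : a <= t <= b by rewrite at_ (le_trans ts sb).
by have := dz (abE atb); rewrite /flowmap flow_quantized.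
Qed.

(** The state at [b] may already lie in the jump set. The strict bounds hold before [b], and
    affinity of the position passes the weak ones to the endpoint. *)
Lemma flow_quantization_error i :
  `|(z b j).2 i 0 - (z b j).1 i 0| <= Delta / 2.
Proof.
have abb : a <= b <= b by rewrite ltW/=.
have near_q s : a <= s -> s < b ->
    (z a j).2 i 0 - Delta / 2 < (z s j).1 i 0 < (z a j).2 i 0 + Delta / 2.
  move=> as_ sb; have asb : a <= s <= b by rewrite as_ ltW.
  have [_ _ _ flow _] := solz; have [_ inC] := flow j slice_interior.
  have [|_ /= /(_ i)] := inC s (abE asb).
    apply: (@lt_le_trans _ _ b%:E); first by rewrite lte_fin.
    by apply: ereal_sup_ubound; exists b => //; exact: abE.
  by rewrite flow_quantized// => -[-> ->].
have posE th : 0 <= th -> th <= 1 -> (z (a + th * (b - a)) j).1 i 0 =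
    (z a j).1 i 0 + th * ((z b j).1 i 0 - (z a j).1 i 0).
  move=> th0 th1.
  have [h0 h1] : 0 <= th * (b - a) /\ th * (b - a) <= b - a.
    by split; [rewrite mulr_ge0//; lra | rewrite ler_piMl//; lra].
  have asb : a <= a + th * (b - a) <= b by apply/andP; split; lra.
  by rewrite (flow_position asb) (flow_position abb) !mxE; ring.
have interp th : 0 <= th -> th < 1 ->
    (z a j).2 i 0 - Delta / 2 <
      (z a j).1 i 0 + th * ((z b j).1 i 0 - (z a j).1 i 0) <
    (z a j).2 i 0 + Delta / 2.
  move=> th0 th1; rewrite -posE ?(ltW th1)//.
  apply: near_q; first by rewrite lerDl mulr_ge0//; lra.
  by rewrite -ltrBrDl gtr_pMl// subr_gt0.
rewrite flow_quantized// distrC ler_norml; apply/andP; split.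
  rewrite -subr_ge0 -oppr_le0; apply: (@affine_half_open_le _
    (- ((z a j).1 i 0 - (z a j).2 i 0 + Delta / 2))) => th th0 th1.
  by have /andP[] := interp th th0 th1; lra.
rewrite -subr_le0; apply: (@affine_half_open_le _
    ((z a j).1 i 0 - (z a j).2 i 0 - Delta / 2)) => th th0 th1.
by have /andP[] := interp th th0 th1; lra.
Qed.

End Flow.

(** * Dissipation outside the limit ball *)

Section Dissipation.
Context {R : realType} {N : nat} (G : wdigraph R N).
Hypotheses (N2 : (2 <= N)%N) (conG : weakly_connected G)
  (balG : weight_balanced G).
Local Notation L := (laplacian G).
Local Notation lam := (lambda2 (Sym (laplacian G))).
Local Notation one := (const_mx 1 : 'cV[R]_N).

Lemma dissipation (x q : 'cV[R]_N) (m d eps : R) (y := x - const_mx m) :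
  0 <= d -> eps < 1 -> dot one y = 0 -> (forall i, `|q i 0 - x i 0| <= d) ->
  (1 - eps)^-1 * (opnorm2 L / lam) * d * Num.sqrt N%:R <= norm2 y ->
  eps * lam * norm2 y ^+ 2 <= dot y (L *m q).
Proof.
move=> d0 eps1 oney xq; have [lam0 ray] := lambda2_Rayleigh N2 conG balG.
have -> : (1 - eps)^-1 * (opnorm2 L / lam) * d * Num.sqrt N%:R =
    opnorm2 L * (d * Num.sqrt N%:R) / (lam * (1 - eps)).
  by field; rewrite !gt_eqF// subr_gt0.
(* Being outside the ball means [||L|| d sqrt N <= (1 - eps) lam |y|], so the quantization error
   costs at most [(1 - eps) lam |y|^2] of the Rayleigh bound [lam |y|^2]. *)
rewrite ler_pdivrMr ?mulr_gt0// ?subr_gt0// => Ky.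
have -> : L *m q = L *m y + L *m (q - x).
  rewrite -mulmxDr [in y + _]addrC /y addrA subrK mulmxBr.
  by rewrite laplacian_mul_const subr0.
rewrite dotDr.
have Lqx : norm2 (L *m (q - x)) <= opnorm2 L * (d * Num.sqrt N%:R).
  apply: le_trans (norm2_mulmx_le _ _) _; rewrite ler_wpM2l ?opnorm2_ge0//.
  by apply: norm2_le_coord => // i; rewrite !mxE.
have := le_trans (dot_le_norm2 y (L *m (q - x)))
  (ler_wpM2l (norm2_ge0 y) (le_trans Lqx Ky)).
rewrite ler_norml => /andP[+ _]; have := ray y oney; rewrite -sqr_norm2.
lra.
Qed.

End Dissipation.

(** Expand the square of [y' + r *: w], where [y'] is the end point, and drop the nonnegative term
    [r ^+ 2 * dot w w]. *)
Lemma dot_sub_ge (R : realType) (N : nat) (y w : 'cV[R]_N) (r c : R) :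
  0 <= r -> c <= dot (y - r *: w) w ->
  dot (y - r *: w) (y - r *: w) <= dot y y - 2 * r * c.
Proof.
move=> r0 c_le; set y' := y - r *: w in c_le *.
have yE : y = y' + r *: w by rewrite subrK.
clearbody y'; rewrite {}yE !dotDr !dotDl !dotZr !dotZl (dotC w).
have := mulr_ge0 (sqr_ge0 r) (dot_ge0 w); have := ler_wpM2l r0 c_le; lra.
Qed.

Lemma mean_const_mx (R : realType) (N : nat) (x : 'cV[R]_N) :
  N%:R^-1 *: (const_mx 1 *m (const_mx 1 : 'cV[R]_N)^T) *m x =
  const_mx (N%:R^-1 * dot (const_mx 1) x) :> 'cV[R]_N.
Proof.
apply/colP => i; rewrite -scalemxAl -mulmxA !mxE big_ord1 !mxE mul1r.
by congr (_ * _); rewrite dotE; apply: eq_bigr => k _; rewrite !mxE.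
Qed.

Lemma dot_one_sub_mean (R : realType) (N : nat) (x : 'cV[R]_N) : (0 < N)%N ->
  dot (const_mx 1) (x - const_mx (N%:R^-1 * dot (const_mx 1) x)) = 0.
Proof.
move=> N0; rewrite dotBr [X in _ - X]dotE.
under eq_bigr do rewrite !mxE mul1r.
rewrite sumr_const card_ord -[X in _ - X]mulr_natl.
by rewrite mulVKf ?subrr// pnatr_eq0 -lt0n.
Qed.

(** * Decay of the disagreement and entry into the ball *)

Section Convergence.
Context {R : realType} {N : nat} (G : wdigraph R N) (Delta eps : R).
Context (E : set (R * nat)) (z : R -> nat -> state R N).
Hypotheses (N2 : (2 <= N)%N) (conG : weakly_connected G)
  (balG : weight_balanced G) (Delta0 : 0 < Delta) (eps0 : 0 < eps) (eps1 : eps < 1).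
Hypothesis solz : consensus_solution Delta (laplacian G) E z.
Local Notation L := (laplacian G).
Local Notation one := (const_mx 1 : 'cV[R]_N).

Let mean := N%:R^-1 * dot one (z 0 0%N).1.
Let y t j := (z t j).1 - const_mx mean.
Let lam := lambda2 (Sym L).
Let K := (1 - eps)^-1 * (opnorm2 L / lam) * (Delta / 2) * Num.sqrt N%:R.
Let rate := eps * lam * K ^+ 2.
(** The invariant carried through flows and jumps. Its first alternative persists because the ball
    is never left; the second is a linear decay of the squared norm at speed [2 * rate]. *)
Let decayed t j := dot one (y t j) = 0 /\
  (norm2 (y t j) <= K \/
   dot (y t j) (y t j) <= dot (y 0 0%N) (y 0 0%N) - 2 * t * rate).

Let lam0 : 0 < lam.
Proof. by have [] := lambda2_Rayleigh N2 conG balG. Qed.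

Lemma ball_radius_gt0 : 0 < K.
Proof.
rewrite !mulr_gt0 ?invr_gt0 ?subr_gt0 ?opnorm2_laplacian_gt0//.
by rewrite sqrtr_gt0 ltr0n ltnW.
Qed.

(* The disagreement is affine along a flow, so its squared norm is convex in
   time: the dissipation at the final time bounds the decrease over the whole
   flow, and no differential inequality is needed. *)
Lemma flow_decay s t j : s <= t -> (forall r, s <= r <= t -> E (r, j)) ->
  decayed s j -> decayed t j.
Proof.
rewrite le_eqVlt => /predU1P[-> //|st] stE [ys_orth ys_le].
have stt : s <= t <= t by rewrite ltW/=.
have yE : y t j = y s j - (t - s) *: (L *m (z s j).2).
  by rewrite /y (flow_position solz st stE stt) addrAC.
have yt_orth : dot one (y t j) = 0.
  by rewrite yE dotBr dotZr dot_const_laplacian// mulr0 subr0.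
split=> //; have [_|Kyt] := leP (norm2 (y t j)) K; [by left|right].
have yt_diss : rate <= dot (y t j) (L *m (z s j).2).
  apply: le_trans (dissipation N2 conG balG _ eps1 yt_orth _ (ltW Kyt)).
  - rewrite /rate ltW// ltr_pM2l ?mulr_gt0// ltr_sqr ?nnegrE ?norm2_ge0//.
    exact/ltW/ball_radius_gt0.
  - by rewrite divr_ge0// ltW.
  - move=> i; rewrite -(flow_quantized solz st stE stt).
    exact: (flow_quantization_error solz st stE).
have ts : 0 <= t - s by rewrite subr_ge0 ltW.
rewrite yE in yt_diss; have := dot_sub_ge ts yt_diss; rewrite -yE => yt_decr.
have rate0 : 0 <= (t - s) * rate.
  exact: mulr_ge0 ts (mulr_ge0 (ltW (mulr_gt0 eps0 lam0)) (sqr_ge0 K)).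
(* A start inside the ball is contradictory: the squared norm has not grown, yet [norm2 (y t j)]
   exceeds [K]. *)
case: ys_le => [ys_le|]; last by lra.
have : dot (y t j) (y t j) <= dot (y s j) (y s j) by lra.
rewrite -!sqr_norm2 ler_sqr ?nnegrE ?norm2_ge0// => /le_trans/(_ ys_le).
by rewrite leNgt Kyt.
Qed.

Lemma solution_decay t j : E (t, j) -> decayed t j.
Proof.
have [domE _ _ _ jump] := solz.
elim: j t => [|j IHj] t Etj;
  have [s [st sE start]] := hybrid_time_domain_slice domE Etj;
  apply: (flow_decay st sE).
  rewrite {}start; split; last by right; rewrite mulr0 mul0r subr0.
  by apply: dot_one_sub_mean; exact: ltnW.
have sst : s <= s <= t by rewrite lexx.
have [_ zE] := jump s j start (sE s sst).
(* A jump fixes [x], the only component of the state that enters [decayed]. *)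
have -> : decayed s j.+1 = decayed s j by rewrite /decayed /y zE.
exact: IHj.
Qed.

Lemma eventually_in_ball : exists2 T : R, 0 < T &
  forall t j, E (t, j) -> T <= t -> norm2 (y t j) <= K.
Proof.
have rate0 : 0 < rate.
  exact: mulr_gt0 (mulr_gt0 eps0 lam0) (exprn_gt0 2 ball_radius_gt0).
have rate20 : 0 < 2 * rate by rewrite pmulr_rgt0.
(* After [dot (y 0 0) (y 0 0) / (2 * rate)] the linear bound reaches zero; one more unit of time
   makes it negative, which excludes the second alternative, and makes [T] positive. *)
exists (dot (y 0 0%N) (y 0 0%N) / (2 * rate) + 1) => [|t j /solution_decay[_ []//]].
  by rewrite ltr_wpDl// divr_ge0 ?dot_ge0// ltW.
have := dot_ge0 (y t j) => y_ge0 y_le.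
rewrite -lerBrDr ler_pdivrMr// => Tt.
exfalso; lra.
Qed.

End Convergence.

Theorem theorem3 (R : realType) (N : nat) (G : wdigraph R N) (Delta : R)
    (E : set (R * nat)) (z : R -> nat -> state R N) :
  (2 <= N)%N ->
  weakly_connected G ->
  weight_balanced G ->
  0 < Delta ->
  consensus_solution Delta (laplacian G) E z ->
  complete_domain E ->
  initset Delta (z 0 0%N) ->
  forall eps : R, 0 < eps -> eps < 1 ->
  exists2 T : R, 0 < T &
    forall (t : R) (j : nat), E (t, j) -> T <= t ->
      norm2 ((z t j).1
             - N%:R^-1 *: (const_mx 1 *m (const_mx 1 : 'cV[R]_N)^T)
               *m (z 0 0%N).1)
      <= (1 - eps)^-1
         * (opnorm2 (laplacian G) / lambda2 (Sym (laplacian G)))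
         * (Delta / 2) * Num.sqrt N%:R.
Proof.
move=> N2 conG balG Delta0 solz _ _ eps eps0 eps1.
have [T T0 in_ball] := eventually_in_ball N2 conG balG Delta0 eps0 eps1 solz.
by exists T => // t j Etj Tt; rewrite mean_const_mx; exact: in_ball.
Qed.
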